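(* Let $\mathbf{X}_t=\sum_{s=1}^p\Phi(s)\mathbf{X}_{t-s}+\varepsilon_t$ be a stationary $N$-variate Gaussian vector autoregressive process with innovation covariance matrix $\Sigma$, let $X,Y$ be components of $\mathbf{X}$, let $\tau>0$ be an integer, and suppose there is a link $X_{t-\tau}\to Y_t$ in the time series graph, with coefficient $c=\Phi_{YX}(\tau)$. Let $\mathbf{Z}_{t-\tau}$ be the row vector of the parents of $X_{t-\tau}$, let $\mathbf{W}_t$ be the row vector of the parents of $Y_t$ other than $X_{t-\tau}$, and assume that the covariance matrix $E[\mathbf{U}^\top\mathbf{U}]$ of $\mathbf{U}=(\mathbf{W}_t,\mathbf{Z}_{t-\tau})$ is invertible. If $E[\varepsilon_{X,t-\tau}\mathbf{W}_t]=0$, then $$\rho^{\rm MIT}_{X\to Y}(\tau)=\frac{c\,\sigma_X}{\sqrt{\sigma_Y^2+c^2\sigma_X^2}} .$$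
   Context: Process: $\mathbf{X}_t$ is a stationary zero-mean $N$-variate discrete-time process, $\Phi(s)$ are real $N\times N$ coefficient matrices, and $\varepsilon_t\sim\mathcal{N}(0,\Sigma)$ are independent and identically distributed in time with $\Sigma$ invertible; $\varepsilon_t$ is independent of the past $\mathbf{X}_{t-1},\mathbf{X}_{t-2},\ldots$. For a component $X$, $\varepsilon_{X,t}$ is the corresponding component of $\varepsilon_t$ and $\sigma_X^2=\Sigma_{XX}$ is its variance, $\sigma_X>0$ (similarly $\sigma_Y^2$). Time series graph: its nodes are the variables $X_t$ for each component $X$ of $\mathbf{X}$ and each time $t$. For this model class, for $\tau>0$ there is a directed link $X_{t-\tau}\to Y_t$ if and only if $\Phi_{YX}(\tau)\neq 0$ (with $\Phi(s)=0$ for $s>p$). The parents of $Y_t$ are $\mathcal{P}_{Y_t}=\{Z_{t-s}: Z \text{ a component of }\mathbf{X},\ s>0,\ Z_{t-s}\to Y_t\}$; past lags of $Y$ itself may be among the parents. For zero-mean random row vectors $\mathbf{a},\mathbf{b}$, $E[\mathbf{a}^\top\mathbf{b}]$ denotes the matrix with entries $E[a_ib_j]$. Partial correlation: for zero-mean scalar variables $X,Y$ and a row vector of regressors $\mathbf{U}$, put $X_{\mathbf{U}}=X-\mathbf{U}(E[\mathbf{U}^\top\mathbf{U}])^{-1}E[\mathbf{U}^\top X]$, and similarly $Y_{\mathbf{U}}$; then $\rho(X;Y\mid\mathbf{U})=E[Y_{\mathbf{U}}X_{\mathbf{U}}]/\bigl(\sqrt{E[Y_{\mathbf{U}}^2]}\sqrt{E[X_{\mathbf{U}}^2]}\bigr)$.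 The MIT is $\rho^{\rm MIT}_{X\to Y}(\tau)=\rho(X_{t-\tau};Y_t\mid\mathcal{P}_{Y_t}\setminus\{X_{t-\tau}\},\mathcal{P}_{X_{t-\tau}})$, i.e. the conditioning vector is $\mathbf{U}=(\mathbf{W}_t,\mathbf{Z}_{t-\tau})$. *)

(* Defs.v *)
From HB Require Import structures.
From mathcomp Require Import all_boot all_order all_algebra.
From mathcomp Require Import all_classical all_reals all_analysis.

Set Implicit Arguments.
Unset Strict Implicit.
Unset Printing Implicit Defensive.

Import Order.TTheory GRing.Theory Num.Theory.
Import numFieldNormedType.Exports.

Local Open Scope classical_set_scope.
Local Open Scope ring_scope.

(* A node (Z, t) of the time series graph stands for the variable Z_t; time
   runs over all of int. *)
Definition node (N : nat) : Type := ('I_N * int)%type.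

Definition linked (R : realType) (N : nat) (Phi : nat -> 'M[R]_N)
    (u v : node N) : bool :=
  (u.2 < v.2) && (Phi `|v.2 - u.2|%N v.1 u.1 != 0).

(* Enumerating the lags up to p loses no parent when Phi vanishes beyond p:
   see mem_parents. *)
Definition parents (R : realType) (N p : nat) (Phi : nat -> 'M[R]_N)
    (v : node N) : seq (node N) :=
  [seq u <- [seq (z, v.2 - s%:Z) | s <- iota 1 p, z <- enum 'I_N]
   | linked Phi u v].

Definition parents_without (R : realType) (N p : nat) (Phi : nat -> 'M[R]_N)
    (v u : node N) : seq (node N) :=
  [seq u' <- parents p Phi v | u' != u].

Lemma parents_uniq (R : realType) (N p : nat) (Phi : nat -> 'M[R]_N)
    (v : node N) : uniq (parents p Phi v).
Proof.
apply/filter_uniq/allpairs_uniq; rewrite ?iota_uniq ?enum_uniq//.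
by move=> [s z] [s' z'] _ _ /= [-> /addrI/oppr_inj [->]].
Qed.

Lemma mem_parents (R : realType) (N p : nat) (Phi : nat -> 'M[R]_N)
    (Phip : forall s, (p < s)%N -> Phi s = 0) (u v : node N) :
  (u \in parents p Phi v) = linked Phi u v.
Proof.
rewrite mem_filter; case luv: (linked Phi u v) => //=.
have /andP[uv nz] := luv.
have vuE : v.2 - u.2 = `|v.2 - u.2|%N%:Z.
  by rewrite gez0_abs// subr_ge0 ltW.
apply/allpairsP; exists (`|v.2 - u.2|%N, u.1); split => /=.
- rewrite mem_iota add1n ltnS absz_gt0 subr_eq0 (gt_eqF uv)/= leqNgt.
  by apply/negP => /Phip Phi0; move: nz; rewrite Phi0 mxE eqxx.
- by rewrite mem_enum.
- by rewrite -vuE subKr; case: (u).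
Qed.

Section Probability.
Context (R : realType) (d : measure_display) (T : measurableType d).
Variable P : probability T R.

Definition sigma_generated (I : Type) (D : set I) (F : I -> T -> R) :
    set (set T) :=
  <<s \bigcup_(i in D) preimage_set_system setT (F i) measurable >>.

Definition independent2 (F G : set (set T)) : Prop :=
  forall A B, F A -> G B -> P (A `&` B) = (P A * P B)%E.

Definition mutually_independent (I : eqType) (F : I -> set (set T)) : Prop :=
  forall (J : seq I) (A : I -> set T), uniq J ->
    (forall j, j \in J -> F j (A j)) ->
    P (\bigcap_(j in [set` J]) A j) = (\prod_(j <- J) P (A j))%E.

(* normal_prob takes the standard deviation and is a junk law when it is 0,
   hence the separate Dirac case. *)
Definition normal_law (m v : R) (B : set R) : \bar R :=
  if v == 0 then \d_m B else normal_prob m (Num.sqrt v) B.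

(* The random vector e has law N(0, Sigma): Sigma is a covariance matrix and
   every linear combination a.e has law N(0, a Sigma a^T). *)
Definition gaussian_vector (N : nat) (Sigma : 'M[R]_N) (e : 'I_N -> T -> R) :
    Prop :=
  [/\ Sigma^T = Sigma,
      (forall a : 'rV[R]_N, 0 <= (a *m Sigma *m a^T) 0 0)
    & forall (a : 'rV[R]_N) (B : set R), measurable B ->
        P ((fun w => \sum_i a 0 i * e i w) @^-1` B) =
        normal_law 0 ((a *m Sigma *m a^T) 0 0) B].

(* Entrywise expectation of a random matrix, so that
   Emx (fun w => (a w)^T *m b w) has entries E[a_i b_j]. *)
Definition Emx (m n : nat) (A : T -> 'M[R]_(m, n)) : 'M[R]_(m, n) :=
  \matrix_(i, j) fine ('E_P[fun w => A w i j])%E.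

Definition second_moment (n : nat) (U : T -> 'rV[R]_n) : 'M[R]_n :=
  Emx (fun w => (U w)^T *m U w).

Definition residual (n : nat) (U : T -> 'rV[R]_n) (x : T -> R) : T -> R :=
  fun w => x w -
    (U w *m invmx (second_moment U) *m Emx (fun w => x w *: (U w)^T)) 0 0.

Definition partial_correlation (n : nat) (x y : T -> R) (U : T -> 'rV[R]_n) :
    R :=
  fine ('E_P[fun w => (residual U y w * residual U x w)%R])%E /
  (Num.sqrt (fine ('E_P[fun w => (residual U y w ^+ 2)%R])%E) *
   Num.sqrt (fine ('E_P[fun w => (residual U x w ^+ 2)%R])%E)).

Section Process.
Variable N : nat.
Implicit Type X : int -> 'I_N -> {RV P >-> R}.

Definition state X (t : int) (w : T) : 'cV[R]_N := \col_i X t i w.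

Definition row_of_nodes X (s : seq (node N)) (w : T) : 'rV[R]_(size s) :=
  \row_i X (tnth (in_tuple s) i).2 (tnth (in_tuple s) i).1 w.

(* Covariance stationarity. *)
Definition stationary_zero_mean X : Prop :=
  [/\ forall t i, (X t i : T -> R) \in Lfun P 2%:E,
      forall t i, ('E_P[X t i] = 0)%E
    & forall s t h i j, covariance P (X (s + h) i) (X (t + h) j) =
                        covariance P (X s i) (X t j)].

Record gaussian_VAR (p : nat) (Phi : nat -> 'M[R]_N) (Sigma : 'M[R]_N)
    (X eps : int -> 'I_N -> {RV P >-> R}) : Prop := GaussianVAR {
  VAR_stationary : stationary_zero_mean X ;
  VAR_order : forall s, (p < s)%N -> Phi s = 0 ;
  VAR_eq : forall t, {ae P, forall w,
    state X t w =
    \sum_(1 <= s < p.+1) Phi s *m state X (t - s%:Z) w + state eps t w} ;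
  VAR_Sigma_unit : Sigma \in unitmx ;
  VAR_innov_gaussian : forall t, gaussian_vector Sigma (fun i => eps t i) ;
  VAR_innov_indep :
    mutually_independent (fun t : int =>
      sigma_generated setT (fun i => eps t i : T -> R)) ;
  VAR_innov_past : forall t,
    independent2 (sigma_generated setT (fun i => eps t i : T -> R))
      (sigma_generated [set u : node N | u.2 < t]
         (fun u => X u.2 u.1 : T -> R)) }.

(* U = (W_t, Z_(t-tau)): the parents of Y_t other than X_(t-tau), followed by
   the parents of X_(t-tau). *)
Definition MIT_conditions (p : nat) (Phi : nat -> 'M[R]_N) X (x y : 'I_N)
    (tau : nat) (t : int) (w : T) :=
  row_mx
    (row_of_nodes X (parents_without p Phi (y, t) (x, t - tau%:Z)) w)
    (row_of_nodes X (parents p Phi (x, t - tau%:Z)) w).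

Definition MIT (p : nat) (Phi : nat -> 'M[R]_N) X (x y : 'I_N) (tau : nat)
    (t : int) : R :=
  partial_correlation (X (t - tau%:Z) x) (X t y)
    (MIT_conditions p Phi X x y tau t).

End Process.
End Probability.

(* Main.v *)
From HB Require Import structures.
Require Import Defs.
From mathcomp Require Import all_boot all_order all_algebra.
From mathcomp Require Import all_classical all_reals all_analysis.
From mathcomp Require Import measurable_realfun ring.

(** Write [t' = t - tau], [W] for the parents of [Y_t] other than [X_t'] and [Z]
    for the parents of [X_t']. The autoregressive equation gives, almost surely,
      [X_t' = Z a + eps_(X,t')]  and  [Y_t = c X_t' + W b + eps_(Y,t)]
    ([VAR_parents], [VAR_parents_without]).

    All regressors in [U = (W, Z)] precede [t], so [eps_(Y,t)] is orthogonal to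
    them; [Z] precedes [t'], so [eps_(X,t')] is orthogonal to [Z], and the
    assumption of the theorem says exactly that it is orthogonal to [W]
    ([innovation_past_orthogonal]). A decomposition into a combination of the
    regressors and an error orthogonal to them is the regression, because the
    normal equations have a unique solution ([residual_ae]). Hence the residual
    of [X_t'] is [eps_(X,t')] and that of [Y_t] is [c eps_(X,t') + eps_(Y,t)].
    The two innovations are uncorrelated ([innovation_uncorrelated]) with
    variances [Sigma x x] and [Sigma y y], so the correlation of the residuals
    is [c Sigma_xx] divided by the product of the square roots of
    [c ^ 2 Sigma_xx + Sigma_yy] and [Sigma_xx].

    Two facts of probability enter: the expectation of a product of independent
    square-integrable variables is the product of the expectations
    ([expectationM_indep]), and the parameter [s] of the normal law really is
    its standard deviation ([normal_second_moment]), which links the covariance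
    matrix of the Gaussian law of the innovations to their second moments. *)

Set Implicit Arguments.
Unset Strict Implicit.
Unset Printing Implicit Defensive.

Import Order.TTheory GRing.Theory Num.Theory.
Import numFieldNormedType.Exports.

Local Open Scope classical_set_scope.
Local Open Scope ring_scope.

(** * Independence *)

(** By independence the joint law of the two variables is the product of their
    laws, as it is on rectangles; Fubini's theorem for the function [x * y]
    concludes. *)
Lemma expectationM_indep (R : realType) (d : measure_display)
    (T : measurableType d) (P : probability T R) (f g : {RV P >-> R}) :
  (f : T -> R) \in Lfun P 2%:E -> (g : T -> R) \in Lfun P 2%:E ->
  (forall A B, measurable A -> measurable B ->
    P (f @^-1` A `&` g @^-1` B) = (P (f @^-1` A) * P (g @^-1` B))%E) ->
  ('E_P[(f \* g)%R] = 'E_P[f] * 'E_P[g])%E.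
Proof.
move=> f2 g2 fg.
have fin : P [set: T] \is a fin_num by rewrite probability_setT.
have f1 : P.-integrable setT (EFin \o f).
  by apply/Lfun1_integrable; exact: Lfun_subset12 f2.
have g1 : P.-integrable setT (EFin \o g).
  by apply/Lfun1_integrable; exact: Lfun_subset12 g2.
have fg1 : P.-integrable setT (EFin \o (f \* g)%R).
  by apply/Lfun1_integrable; exact: Lfun2_mul_Lfun1.
pose h (w : T) := (f w, g w).
have mh : measurable_fun setT h.
  have mf : measurable_fun setT (f : T -> R) by exact: measurable_funP.
  have mg : measurable_fun setT (g : T -> R) by exact: measurable_funP.
  exact: measurable_fun_pair.
pose hh : {RV P >-> (R * R)%type} :=
  HB.pack h (isMeasurableFun.Build _ _ _ _ h mh).
pose Q := (distribution P f \x distribution P g)%E.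
have prodE A : measurable A -> Q A = distribution P hh A.
  move: A.
  apply: (product_measure_unique (m' := distribution P hh)) => B C mB mC.
  by rewrite /distribution /pushforward -fg.
pose m (z : R * R) := (z.1 * z.2)%:E.
have mm : measurable_fun setT m.
  by apply/measurable_EFinP; apply: measurable_funM.
have intE (k : {RV P >-> R}) : P.-integrable setT (EFin \o k) ->
    (distribution P k).-integrable setT (@EFin R).
  by move=> k1; apply: integrable_pushforward.
have mE : (\int[Q]_z m z = 'E_P[(f \* g)%R])%E.
  rewrite unlock -(integral_distribution (X := hh) mm)//.
  by apply: eq_measure_integral => A mA _; exact: prodE.
have mQ : Q.-integrable setT m.
  have /integrableP[_ h1] : (distribution P hh).-integrable setT m.
    exact: integrable_pushforward.
  apply/integrableP; split => //.
  rewrite (eq_measure_integral (distribution P hh))//.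
  by move=> A mA _; exact: prodE.
have EE (k : {RV P >-> R}) : P.-integrable setT (EFin \o k) ->
    (\int[distribution P k]_z z%:E = (fine 'E_P[k])%:E)%E.
  move=> k1; rewrite integral_distribution//= fineK ?[in RHS]unlock//.
  by apply: expectation_fin_num; exact/Lfun1_integrable.
rewrite -mE -integral12_prod_meas1//.
under eq_integral.
  move=> x _; rewrite /fubini_F/=.
  under eq_integral => z _ do rewrite /m EFinM.
  rewrite integralZl//; last exact: intE.
  rewrite EE//.
  over.
rewrite integralZr//; last exact: intE.
by rewrite EE// !fineK//; apply: expectation_fin_num; exact/Lfun1_integrable.
Qed.

(** * Variance of the normal law *)

(** The density of a measure with respect to another one is unique up to
    equality almost everywhere, so the Radon-Nikodym derivative in the change of
    variables formula can be replaced by the explicit one. *)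
Lemma ge0_integral_normal_prob (R : realType) (m s : R) (f : R -> \bar R) :
  (forall x, 0 <= f x)%E -> measurable_fun setT f ->
  (\int[normal_prob m s]_x f x =
   \int[lebesgue_measure]_x (f x * (normal_pdf m s x)%:E))%E.
Proof.
move=> f0 mf; pose mu := @lebesgue_measure R.
have dom : normal_prob m s `<< mu := normal_prob_dominates m s.
rewrite -(Radon_Nikodym_SigmaFinite.change_of_variables dom)//.
have intg := Radon_Nikodym_SigmaFinite.f_integrable dom.
apply: ae_eq_integral => //.
- by apply: emeasurable_funM => //; exact: (measurable_int mu).
- apply: emeasurable_funM => //.
  by apply/measurable_EFinP; exact: measurable_normal_pdf.
- apply: ae_eqe_mul2l; apply: integral_ae_eq => //.
  + by apply/measurable_EFinP; exact: measurable_normal_pdf.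
  + by move=> A _ mA; rewrite -Radon_Nikodym_SigmaFinite.f_integral.
Qed.

Section normal_second_moment.
Variables (R : realType) (s : R).
Hypothesis s_gt0 : 0 < s.
Local Notation mu := (@lebesgue_measure R).
Local Notation pdf := (normal_pdf 0 s).

(** By the differential equation [s ^ 2 * pdf' x = - x * pdf x], this function
    is an antiderivative of [(x ^ 2 - s ^ 2) * pdf x]. As it vanishes at 0 and
    at infinity, integrating [x ^ 2] against the density gives [s ^ 2] times the
    total mass. *)
Let F (x : R) : R := - s ^+ 2 * (x * pdf x).

Let is_derive_F (x : R) : is_derive x 1 F ((x ^+ 2 - s ^+ 2) * pdf x).
Proof.
have s0 : s != 0 by rewrite gt_eqF.
rewrite /F normal_pdfE//= /normal_fun.
apply: is_derive_eq.
rewrite /GRing.scale/= subr0.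
by field.
Qed.

Let continuous_F : continuous F.
Proof.
move=> x; apply: differentiable_continuous; apply/derivable1_diffP.
exact: ex_derive.
Qed.

Let cvg_F : F x @[x --> +oo] --> (0 : R).
Proof.
have s0 : s != 0 by rewrite gt_eqF.
pose K := s ^+ 2 * normal_peak s * (s ^+ 2 *+ 2).
have K0 : 0 < K.
  by rewrite !mulr_gt0 ?normal_peak_gt0 ?exprn_gt0// mulrn_wgt0 ?exprn_gt0.
apply/cvgrPdist_le => e e0; near=> x.
have x0 : 0 < x by near: x; exact: nbhs_pinfty_gt.
have Kx : K / e <= x by near: x; apply: nbhs_pinfty_ge; rewrite num_real.
(* From [1 + z <= expR z] at [z = x ^ 2 / (2 * s ^ 2)]. *)
have pdf_le : x ^+ 2 * pdf x <= normal_peak s * (s ^+ 2 *+ 2).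
  rewrite normal_pdfE//= /normal_fun subr0 mulrCA ler_pM2l ?normal_peak_gt0//.
  have q0 : 0 < s ^+ 2 *+ 2 by rewrite mulrn_wgt0 ?exprn_gt0.
  rewrite mulNr expRN ler_pdivrMr ?expR_gt0// mulrC -ler_pdivrMr//.
  by apply: le_trans (expR_ge1Dx _); rewrite lerDr.
rewrite sub0r normrN /F mulNr normrN ger0_norm; last first.
  by rewrite !mulr_ge0 ?normal_pdf_ge0 ?exprn_ge0// ltW.
rewrite -(ler_pM2l x0) (@le_trans _ _ K)//.
  rewrite /K -mulrA [leLHS]mulrCA ler_pM2l ?exprn_gt0//.
  by rewrite mulrA -expr2.
by rewrite -ler_pdivrMr.
Unshelve. all: by end_near. Qed.

Let cont_g (a : R) : continuous (fun x : R => (x ^+ 2 - a) * pdf x).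
Proof.
have s0 : s != 0 by rewrite gt_eqF.
move=> x; apply: cvgM; last exact: continuous_normal_pdf.
apply: cvgB; last exact: cvg_cst.
exact: sqr_continuous.
Qed.

(** The half-line is cut at [s], where [x ^ 2 - s ^ 2] changes sign, so
    that the fundamental theorem of calculus is applied to a nonnegative
    function on the unbounded part. The two boundary terms at [s] cancel. *)
Lemma integral0y_sqr_normal_pdf :
  (\int[mu]_(x in `[0%R, +oo[) (x ^+ 2 * pdf x)%:E =
   (s ^+ 2)%:E * \int[mu]_(x in `[0%R, +oo[) (pdf x)%:E)%E.
Proof.
have s0 : s != 0 by rewrite gt_eqF.
have intF0s : (\int[mu]_(x in `[0%R, s]) ((x ^+ 2 - s ^+ 2) * pdf x)%:E =
    (F s)%:E)%E.
  rewrite (@continuous_FTC2 _ _ F)//.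
  - by rewrite /F mul0r mulr0 sube0.
  - exact/continuous_subspaceT/cont_g.
  - split => //.
    + by move=> x _; exact: ex_derive.
    + by apply/cvg_at_right_filter/continuous_F.
    + by apply/cvg_at_left_filter/continuous_F.
  - by move=> x _; rewrite derive1E; exact: derive_val.
have intFsy : (\int[mu]_(x in `[s, +oo[) ((x ^+ 2 - s ^+ 2) * pdf x)%:E =
    - (F s)%:E)%E.
  rewrite (@ge0_continuous_FTC2y _ _ F _ 0); first by rewrite sub0e.
  - move=> x sx; rewrite mulr_ge0 ?normal_pdf_ge0// subr_ge0.
    by rewrite ler_pXn2r// nnegrE ltW// (lt_le_trans s_gt0).
  - exact/continuous_subspaceT/cont_g.
  - exact: cvg_F.
  - by move=> x _; exact: ex_derive.
  - by apply/cvg_at_right_filter/continuous_F.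
  - by move=> x _; rewrite derive1E; exact: derive_val.
have split_sqr (D : set R) : measurable D ->
  mu.-integrable D (fun x => ((x ^+ 2 - s ^+ 2) * pdf x)%:E) ->
  (\int[mu]_(x in D) (x ^+ 2 * pdf x)%:E =
   \int[mu]_(x in D) ((x ^+ 2 - s ^+ 2) * pdf x)%:E +
   (s ^+ 2)%:E * \int[mu]_(x in D) (pdf x)%:E)%E.
  move=> mD intg.
  have intp : mu.-integrable D (fun x => (pdf x)%:E).
    exact: integrableS (integrable_normal_pdf 0 s).
  rewrite -integralZl// -integralD//; last exact: integrableZl.
  by apply: eq_integral => x _; rewrite -EFinM -EFinD mulrBl subrK.
have mpdf (D : set R) : measurable_fun D (fun x => (pdf x)%:E).
  by apply/measurable_EFinP/measurable_funTS; exact: measurable_normal_pdf.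
have mg a (D : set R) : measurable_fun D (fun x => ((x ^+ 2 - a) * pdf x)%:E).
  apply/measurable_EFinP/measurable_funTS.
  by apply: continuous_measurable_fun; exact: cont_g.
have msqr (D : set R) : measurable_fun D (fun x => (x ^+ 2 * pdf x)%:E).
  have := mg 0 D; apply: eq_measurable_fun => x _.
  by rewrite subr0.
have cut (f : R -> \bar R) : measurable_fun setT f ->
  (\int[mu]_(x in `[0%R, +oo[) f x =
   \int[mu]_(x in `[0%R, s]) f x + \int[mu]_(x in `[s, +oo[) f x)%E.
  move=> mf; rewrite -(integral_itv_obnd_cbnd (r := s)); last first.
    exact: measurable_funTS.
  rewrite -integral_setU//; last 2 first.
  - exact: measurable_funTS.
  - apply/disj_set2P; rewrite -subset0 => x [] /=; rewrite !in_itv/= andbT.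
    by move=> /andP[_ xs] sx; move: (lt_le_trans sx xs); rewrite ltxx.
  by rewrite -itv_bndbnd_setU// bnd_simp ltW.
rewrite !cut// !split_sqr//; last 2 first.
- apply/integrableP; split; first exact: mg.
  rewrite [ltLHS](_ : _ = (- (F s)%:E)%E) ?ltry// -intFsy.
  apply: eq_integral => x; rewrite inE/= in_itv/= andbT => sx.
  rewrite ger0_norm//.
  rewrite mulr_ge0 ?normal_pdf_ge0// subr_ge0.
  by rewrite ler_pXn2r// nnegrE ltW// (lt_le_trans s_gt0).
- apply: continuous_compact_integrable; first exact: segment_compact.
  exact/continuous_subspaceT/cont_g.
have pos (D : set R) : (0 <= \int[mu]_(x in D) (pdf x)%:E)%E.
  by apply: integral_ge0 => x _; rewrite lee_fin normal_pdf_ge0.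
rewrite intF0s intFsy (ge0_muleDr _ (pos _) (pos _)).
by rewrite addeACA -EFinN -EFinD subrr add0e.
Qed.

Lemma normal_second_moment :
  (\int[normal_prob 0 s]_x (x ^+ 2)%:E = (s ^+ 2)%:E)%E.
Proof.
have s0 : s != 0 by rewrite gt_eqF.
rewrite ge0_integral_normal_prob; last 2 first.
- by move=> x; rewrite lee_fin sqr_ge0.
- by apply/measurable_EFinP.
have even_pdf (x : R) : pdf (- x) = pdf x.
  by rewrite !normal_pdfE//= /normal_fun !subr0 sqrrN.
under eq_integral do rewrite -EFinM.
rewrite ge0_symfun_integralT; last 3 first.
- by move=> x; rewrite mulr_ge0 ?sqr_ge0 ?normal_pdf_ge0.
- by have := @cont_g 0; under eq_fun do rewrite subr0.
- by move=> x /=; rewrite sqrrN even_pdf.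
rewrite -set_itvcy integral0y_sqr_normal_pdf muleCA.
rewrite set_itvcy -ge0_symfun_integralT ?integral_normal_pdf ?mule1//.
- by move=> x; exact: normal_pdf_ge0.
- exact: continuous_normal_pdf.
- by move=> x /=; rewrite even_pdf.
Qed.

End normal_second_moment.

(** * Second moments and linear regression *)

Section cross_moments.
Context {R : realType} {d : measure_display} {T : measurableType d}.
Variable P : probability T R.
Implicit Types f g h : T -> R.

(** The inner product of the Hilbert space of square-integrable variables. *)
Definition cross_moment f g : R := fine 'E_P[fun w => (f w * g w)%R]%E.

Lemma cross_momentC f g : cross_moment f g = cross_moment g f.
Proof. by congr (fine 'E_P[_]%E); apply/funext => w; rewrite mulrC. Qed.

Lemma cross_momentDl f g h :
  f \in Lfun P 2%:E -> g \in Lfun P 2%:E -> h \in Lfun P 2%:E ->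
  cross_moment (f \+ g) h = cross_moment f h + cross_moment g h.
Proof.
move=> f2 g2 h2; have fh := Lfun2_mul_Lfun1 f2 h2.
have gh := Lfun2_mul_Lfun1 g2 h2.
rewrite /cross_moment -fineD; [|exact: expectation_fin_num..].
rewrite -expectationD//; congr (fine 'E_P[_]%E).
by apply/funext => w /=; rewrite mulrDl.
Qed.

Lemma cross_momentZl (c : R) f h :
  f \in Lfun P 2%:E -> h \in Lfun P 2%:E ->
  cross_moment (c *: f) h = c * cross_moment f h.
Proof.
move=> f2 h2; have fh := Lfun2_mul_Lfun1 f2 h2.
transitivity (fine (c%:E * 'E_P[(f \* h)%R])%E).
  rewrite -expectationZl//; congr (fine 'E_P[_]%E).
  by apply/funext => w /=; rewrite [RHS]mulrC mulrA.
by rewrite fineM//; exact: expectation_fin_num.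
Qed.

Lemma Lfun2_sum (I : Type) (r : seq I) (c : I -> R) (F : I -> T -> R) :
  (forall i, F i \in Lfun P 2%:E) ->
  (fun w => \sum_(i <- r) c i * F i w) \in Lfun P 2%:E.
Proof.
move=> F2; rewrite (_ : (fun w => _) = \sum_(i <- r) c i *: F i); last first.
  by apply/funext => w; rewrite fct_sumE.
by apply: rpred_sum => [|p1 i _]; rewrite ?lee1n//; exact: rpredZ.
Qed.

Lemma cross_moment_suml (I : Type) (r : seq I) (c : I -> R) (F : I -> T -> R)
    h :
  (forall i, F i \in Lfun P 2%:E) -> h \in Lfun P 2%:E ->
  cross_moment (fun w => \sum_(i <- r) c i * F i w) h =
  \sum_(i <- r) c i * cross_moment (F i) h.
Proof.
move=> F2 h2; elim: r => [|i r IH].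
  rewrite big_nil /cross_moment (_ : (fun w => _) = cst 0) ?expectation_cst//.
  by apply/funext => w; rewrite big_nil mul0r.
rewrite big_cons -IH -cross_momentZl// -cross_momentDl//; last 2 first.
- by rewrite rpredZ ?lee1n.
- exact: Lfun2_sum.
by congr cross_moment; apply/funext => w; rewrite big_cons.
Qed.

Lemma cross_moment_ae f f' h :
  measurable_fun setT f -> measurable_fun setT f' -> measurable_fun setT h ->
  {ae P, forall w, f w = f' w} -> cross_moment f h = cross_moment f' h.
Proof.
move=> mf mf' mh ff'; rewrite /cross_moment !unlock; congr fine.
apply: ae_eq_integral => //.
- by apply/measurable_EFinP; exact: measurable_funM.
- by apply/measurable_EFinP; exact: measurable_funM.
- by apply: filterS ff' => w -> _.
Qed.

Lemma Lfun2_measurable f : f \in Lfun P 2%:E -> measurable_fun setT f.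
Proof. by rewrite inE => /andP[/[!inE]]. Qed.

End cross_moments.

Section regression.
Context {R : realType} {d : measure_display} {T : measurableType d}.
Variable P : probability T R.
Variables (n : nat) (U : T -> 'rV[R]_n).
Hypothesis U2 : forall j, (fun w => U w 0 j) \in Lfun P 2%:E.
Hypothesis SU : second_moment P U \in unitmx.

Let linear_partE (a : 'cV[R]_n) w :
  (U w *m a) 0 0 = \sum_j a j 0 * U w 0 j.
Proof. by rewrite mxE; apply: eq_bigr => j _; rewrite mulrC. Qed.

Let linear_part_Lfun2 (a : 'cV[R]_n) :
  (fun w => (U w *m a) 0 0) \in Lfun P 2%:E.
Proof.
by under eq_fun do rewrite linear_partE; exact: Lfun2_sum.
Qed.

Lemma residual_Lfun2 (x : T -> R) :
  x \in Lfun P 2%:E -> residual P U x \in Lfun P 2%:E.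
Proof.
move=> x2; rewrite /residual; under eq_fun do rewrite -mulmxA.
by apply: rpredB; rewrite ?lee1n.
Qed.

(** The regression of [x] on [U] is the orthogonal projection on the span of
    the entries of [U]. When [x] is already split into a combination of them and
    an error orthogonal to them, the normal equations read
    [Emx P (x *: U^T) = second_moment P U *m a]; since the second moment matrix
    is invertible they return the coefficients [a], and the error is what
    remains. *)
Lemma residual_ae (x e : T -> R) (a : 'cV[R]_n) :
  x \in Lfun P 2%:E -> e \in Lfun P 2%:E ->
  (forall j, cross_moment P e (fun w => U w 0 j) = 0) ->
  {ae P, forall w, x w = (U w *m a) 0 0 + e w} ->
  {ae P, forall w, residual P U x w = e w}.
Proof.
move=> x2 e2 eU xE.
have normal_eq : Emx P (fun w => x w *: (U w)^T) = second_moment P U *m a.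
  apply/matrixP => i j; rewrite ord1 !mxE {j}.
  transitivity (cross_moment P x (fun w => U w 0 i)).
    by congr (fine 'E_P[_]%E); apply/funext => w; rewrite !mxE.
  rewrite (cross_moment_ae _ _ _ xE); last 3 first.
  - exact: Lfun2_measurable x2.
  - apply: (@Lfun2_measurable _ _ _ P); apply: rpredD => //.
    by rewrite lee1n.
  - exact: Lfun2_measurable (U2 i).
  rewrite cross_momentDl// eU addr0.
  rewrite (_ : (fun w => _) = fun w => \sum_j a j 0 * U w 0 j); last first.
    by apply/funext => w; rewrite linear_partE.
  rewrite cross_moment_suml//; apply: eq_bigr => j _.
  rewrite mulrC; congr (_ * _).
  rewrite cross_momentC mxE; congr (fine 'E_P[_]%E); apply/funext => w.
  by rewrite !mxE big_ord1 !mxE.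
apply: filterS xE => w xw.
by rewrite /residual normal_eq -mulmxA mulKmx// xw addrC addKr.
Qed.

(** The residual of [x] is [ex] and that of [y] is [c *: ex + ey]: the part of
    [c * x] explained by [U] is removed with [U *m b]. The two errors being
    orthogonal, the partial correlation is that of [ex] with [c *: ex + ey]. *)
Lemma partial_correlation_regression (x y ex ey : T -> R) (a b : 'cV[R]_n)
    (c : R) :
  x \in Lfun P 2%:E -> y \in Lfun P 2%:E ->
  ex \in Lfun P 2%:E -> ey \in Lfun P 2%:E ->
  (forall j, cross_moment P ex (fun w => U w 0 j) = 0) ->
  (forall j, cross_moment P ey (fun w => U w 0 j) = 0) ->
  cross_moment P ey ex = 0 ->
  {ae P, forall w, x w = (U w *m a) 0 0 + ex w} ->
  {ae P, forall w, y w = c * x w + (U w *m b) 0 0 + ey w} ->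
  partial_correlation P x y U =
  c * cross_moment P ex ex /
  (Num.sqrt (c ^+ 2 * cross_moment P ex ex + cross_moment P ey ey) *
   Num.sqrt (cross_moment P ex ex)).
Proof.
move=> x2 y2 ex2 ey2 exU eyU eyx xE yE.
pose r := c *: ex + ey.
have cex2 : c *: ex \in Lfun P 2%:E by rewrite rpredZ ?lee1n.
have r2 : r \in Lfun P 2%:E by apply: rpredD => //; rewrite lee1n.
have r_moment h : h \in Lfun P 2%:E ->
    cross_moment P r h = c * cross_moment P ex h + cross_moment P ey h.
  by move=> h2; rewrite cross_momentDl// cross_momentZl.
have resx := residual_ae x2 ex2 exU xE.
have resy : {ae P, forall w, residual P U y w = r w}.
  (* Substituting x in y, the coefficients of U are c a + b. *)
  apply: (residual_ae (a := c *: a + b) y2 r2) => [j|].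
    by rewrite r_moment// exU eyU mulr0 addr0.
  apply: filterS2 xE yE => w xw yw.
  rewrite yw xw /r mulmxDr -scalemxAr !mxE.
  rewrite -[(c *: ex + ey) w]/(c * ex w + ey w).
  by ring.
have mrx := Lfun2_measurable (residual_Lfun2 x2).
have mry := Lfun2_measurable (residual_Lfun2 y2).
have mex := Lfun2_measurable ex2.
have mr := Lfun2_measurable r2.
have momentE (f f' g g' : T -> R) :
    measurable_fun setT f -> measurable_fun setT f' ->
    measurable_fun setT g -> measurable_fun setT g' ->
    {ae P, forall w, f w = f' w} -> {ae P, forall w, g w = g' w} ->
    cross_moment P f g = cross_moment P f' g'.
  move=> mf mf' mg mg' ff' gg'.
  rewrite (cross_moment_ae (f := f) (f' := f'))// cross_momentC.
  rewrite (cross_moment_ae (f := g) (f' := g'))//.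
  exact: cross_momentC.
have E1 : fine ('E_P[fun w => (residual P U y w * residual P U x w)%R])%E =
    c * cross_moment P ex ex.
  rewrite -[LHS]/(cross_moment P (residual P U y) (residual P U x)).
  by rewrite (momentE _ r _ ex)// r_moment// eyx addr0.
have sqrE (f : T -> R) :
    fine ('E_P[fun w => (f w ^+ 2)%R])%E = cross_moment P f f.
  by congr (fine 'E_P[_]%E); apply/funext => w; rewrite expr2.
rewrite /partial_correlation E1 !sqrE.
rewrite (momentE (residual P U y) r (residual P U y) r)//.
rewrite (momentE (residual P U x) ex (residual P U x) ex)//.
congr (_ / (Num.sqrt _ * _)).
rewrite r_moment// cross_momentC r_moment// eyx.
rewrite (cross_momentC _ ey r) r_moment//.
by rewrite (cross_momentC _ ex ey) eyx; ring.
Qed.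

End regression.

(** * Gaussian vectors *)

Section gaussian_second_moment.
Context {R : realType} {d : measure_display} {T : measurableType d}.
Variables (P : probability T R) (N : nat) (Sigma : 'M[R]_N).
Variable e : 'I_N -> {RV P >-> R}.
Hypothesis gauss_e : gaussian_vector P Sigma (fun i => e i).

Lemma gaussian_vector_diag i :
  0 <= Sigma i i /\
  forall B, measurable B -> P (e i @^-1` B) = normal_law 0 (Sigma i i) B.
Proof.
have [_ Sigma_ge0 law] := gauss_e.
pose a : 'rV[R]_N := delta_mx 0 i.
have SE : (a *m Sigma *m a^T) 0 0 = Sigma i i.
  by rewrite -rowE trmx_delta -colE !mxE.
have eE : (fun w => \sum_j a 0 j * e j w) = e i.
  apply/funext => w.
  rewrite (bigD1 i)//= !mxE !eqxx mul1r big1 ?addr0// => j ji.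
  by rewrite !mxE eqxx (negbTE ji) mul0r.
split=> [|B mB]; first by rewrite -SE.
by rewrite -SE -law// eE.
Qed.

(** The entry has the centred normal law of variance [Sigma i i], or the Dirac
    law at 0 when that variance is 0. *)
Lemma gaussian_vector_second_moment i :
  'E_P[fun w => (e i w ^+ 2)%R]%E = (Sigma i i)%:E.
Proof.
have [Sii law] := gaussian_vector_diag i.
(* The normal law is a measure on measurableTypeR R, which has the same
   measurable sets as R but is another structure; e i is repackaged to match. *)
pose ei : T -> measurableTypeR R := e i.
have mei : measurable_fun setT ei by exact: (measurable_funP (e i)).
pose X : {RV P >-> measurableTypeR R} :=
  HB.pack ei (isMeasurableFun.Build _ _ _ _ ei mei).
have msqr : measurable_fun [set: measurableTypeR R]
    (fun x : measurableTypeR R => ((x : R) ^+ 2)%:E).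
  by apply/measurable_EFinP; exact: measurable_funX.
rewrite unlock -[LHS](ge0_integral_distribution X msqr); last first.
  by move=> y; rewrite lee_fin sqr_ge0.
have [S0|S0] := eqVneq (Sigma i i) 0.
  rewrite (eq_measure_integral (\d_(0 : measurableTypeR R))); last first.
    by move=> A mA _; move: (law A mA); rewrite /normal_law S0 eqxx.
  by rewrite integral_dirac// diracT mul1e S0 expr0n.
rewrite (eq_measure_integral (normal_prob 0 (Num.sqrt (Sigma i i)))).
  rewrite normal_second_moment ?sqr_sqrtr//.
  by rewrite sqrtr_gt0 lt_neqAle eq_sym S0.
by move=> A mA _; move: (law A mA); rewrite /normal_law (negbTE S0).
Qed.

Lemma gaussian_vector_Lfun2 i : (e i : T -> R) \in Lfun P 2%:E.
Proof.
rewrite inE; apply/andP; split; rewrite inE//=.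
rewrite /finite_norm unlock poweR_lty//.
rewrite (_ : (\int[_]_x _ = (Sigma i i)%:E)%E) ?ltry//.
rewrite -gaussian_vector_second_moment unlock; apply: eq_integral => w _.
by rewrite poweR_EFin powR_mulrn// -normrX ger0_norm ?sqr_ge0.
Qed.

End gaussian_second_moment.

(** * The autoregressive process *)

Section VAR.
Context {R : realType} {d : measure_display} {T : measurableType d}.
Variables (P : probability T R) (N p : nat).
Variables (Phi : nat -> 'M[R]_N) (Sigma : 'M[R]_N).
Variables X eps : int -> 'I_N -> {RV P >-> R}.
Hypothesis VAR : gaussian_VAR p Phi Sigma X eps.

Definition lag_coef (v u : node N) : R := Phi `|v.2 - u.2|%N v.1 u.1.

Lemma VAR_Lfun2 t i : (X t i : T -> R) \in Lfun P 2%:E.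
Proof. by have [X2 _ _] := VAR_stationary VAR; exact: X2. Qed.

Lemma innovation_Lfun2 t i : (eps t i : T -> R) \in Lfun P 2%:E.
Proof.
exact: gaussian_vector_Lfun2 (VAR_innov_gaussian VAR t) i.
Qed.

Lemma innovation_variance t i :
  cross_moment P (eps t i) (eps t i) = Sigma i i.
Proof.
have := gaussian_vector_second_moment (VAR_innov_gaussian VAR t) i.
rewrite /cross_moment; under eq_fun do rewrite expr2.
by move=> ->.
Qed.

(** Independence makes the expectation of the product the product of the
    expectations, and the process is centred. *)
Lemma innovation_past_orthogonal t i (u : node N) : u.2 < t ->
  cross_moment P (eps t i) (X u.2 u.1) = 0.
Proof.
move=> ut; have [_ EX _] := VAR_stationary VAR.
rewrite /cross_moment -/(eps t i \* X u.2 u.1).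
rewrite (expectationM_indep (f := eps t i) (g := X u.2 u.1)).
- by rewrite EX mule0.
- exact: innovation_Lfun2.
- exact: VAR_Lfun2.
move=> A B mA mB; apply: (VAR_innov_past VAR).
- apply: sub_sigma_algebra; exists i => //; exists A => //.
  by rewrite setTI.
- apply: sub_sigma_algebra; exists u => //; exists B => //.
  by rewrite setTI.
Qed.

(** In the autoregressive equation only the linked nodes have a nonzero
    coefficient. *)
Lemma VAR_parents (v : node N) :
  {ae P, forall w, X v.2 v.1 w =
    \sum_(u <- parents p Phi v) lag_coef v u * X u.2 u.1 w + eps v.2 v.1 w}.
Proof.
apply: filterS (VAR_eq VAR v.2) => w.
move/(congr1 (fun M : 'cV[R]_N => M v.1 0)).
rewrite !mxE => ->; congr (_ + _).
rewrite summxE /parents big_filter [RHS]big_mkcond/= big_allpairs_dep/=.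
rewrite /index_iota subn1/= !big_seq; apply: eq_bigr => s.
rewrite mem_iota => /andP[s_gt0 _].
rewrite mxE big_enum/=; apply: eq_bigr => z _.
rewrite mxE /linked /lag_coef/= opprB addrC subrK absz_nat.
have -> : v.2 - s%:Z < v.2 by rewrite ltrBlDr ltrDl ltz_nat.
by case: eqP => [->|]; rewrite ?mul0r.
Qed.

Lemma parents_past (v u : node N) : u \in parents p Phi v -> u.2 < v.2.
Proof. by rewrite (mem_parents (VAR_order VAR)) => /andP[]. Qed.

Lemma VAR_parents_without (v u : node N) : linked Phi u v ->
  {ae P, forall w, X v.2 v.1 w = lag_coef v u * X u.2 u.1 w +
    \sum_(u' <- parents_without p Phi v u) lag_coef v u' * X u'.2 u'.1 w +
    eps v.2 v.1 w}.
Proof.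
move=> uv; apply: filterS (VAR_parents v) => w ->; congr (_ + _).
rewrite (bigD1_seq u) ?parents_uniq ?(mem_parents (VAR_order VAR))//=.
by rewrite big_filter.
Qed.

(** An earlier innovation is a combination of the process up to its own time,
    by the autoregressive equation, so that orthogonality to the past of the
    process suffices. *)
Lemma innovation_uncorrelated s t i j : s < t ->
  cross_moment P (eps t i) (eps s j) = 0.
Proof.
move=> st; have orth := @innovation_past_orthogonal t i.
have XE := VAR_parents (j, s).
have S2 : (fun w => \sum_(u <- parents p Phi (j, s))
    lag_coef (j, s) u * X u.2 u.1 w) \in Lfun P 2%:E.
  exact: (Lfun2_sum _ _ (fun u : node N => VAR_Lfun2 u.2 u.1)).
have := orth (j, s) st; rewrite /= cross_momentC.
rewrite (cross_moment_ae _ _ _ XE); last 3 first.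
- exact: Lfun2_measurable (VAR_Lfun2 s j).
- apply: (@Lfun2_measurable _ _ _ P); apply: rpredD => [|//|p1].
  + by rewrite lee1n.
  + exact: innovation_Lfun2.
- exact: Lfun2_measurable (innovation_Lfun2 t i).
rewrite cross_momentDl//; [|exact: innovation_Lfun2..].
rewrite (cross_moment_suml _ _ (fun u : node N => VAR_Lfun2 u.2 u.1)).
  2: exact: innovation_Lfun2.
rewrite big_seq big1 ?add0r => [|u /parents_past /= us].
  by rewrite cross_momentC.
by rewrite cross_momentC orth ?mulr0// (lt_trans us st).
Qed.

Lemma row_of_nodes_mul (s : seq (node N)) (k : node N -> R) w :
  (row_of_nodes X s w *m \col_i k (tnth (in_tuple s) i)) 0 0 =
  \sum_(u <- s) k u * X u.2 u.1 w.
Proof.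
by rewrite mxE [RHS]big_tnth; apply: eq_bigr => i _; rewrite !mxE mulrC.
Qed.

End VAR.

(** * The momentary information transfer *)

Theorem mainTheorem2 (R : realType) (d : measure_display)
    (T : measurableType d) (P : probability T R)
    (N p : nat) (Phi : nat -> 'M[R]_N) (Sigma : 'M[R]_N)
    (X eps : int -> 'I_N -> {RV P >-> R})
    (x y : 'I_N) (tau : nat) (t : int) :
  gaussian_VAR p Phi Sigma X eps ->
  (0 < tau)%N ->
  linked Phi (x, t - tau%:Z) (y, t) ->
  second_moment P (MIT_conditions p Phi X x y tau t) \in unitmx ->
  Emx P (fun w => eps (t - tau%:Z) x w *:
           row_of_nodes X (parents_without p Phi (y, t) (x, t - tau%:Z)) w)
    = 0 ->
  let c := Phi tau y x in
  let sigma_x := Num.sqrt (Sigma x x) in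
  let sigma_y := Num.sqrt (Sigma y y) in
  MIT p Phi X x y tau t =
    c * sigma_x / Num.sqrt (sigma_y ^+ 2 + c ^+ 2 * sigma_x ^+ 2).
Proof.
move=> VAR tau_gt0 link SU epsW c sigma_x sigma_y.
set t' := t - tau%:Z in link epsW *.
have t't : t' < t by rewrite ltrBlDr ltrDl ltz_nat.
set W := parents_without p Phi (y, t) (x, t') in epsW.
set Z := parents p Phi (x, t').
set U := MIT_conditions p Phi X x y tau t in SU.
have rowE (s : seq (node N)) j :
    (fun w => row_of_nodes X s w 0 j) =
    X (tnth (in_tuple s) j).2 (tnth (in_tuple s) j).1.
  by apply/funext => w; rewrite mxE.
have UW j : (fun w => U w 0 (lshift _ j)) = (fun w => row_of_nodes X W w 0 j).
  by apply/funext => w; rewrite /U /MIT_conditions row_mxEl.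
have UZ j : (fun w => U w 0 (rshift _ j)) = (fun w => row_of_nodes X Z w 0 j).
  by apply/funext => w; rewrite /U /MIT_conditions row_mxEr.
have tnthW j : (tnth (in_tuple W) j).2 < t.
  have := mem_tnth j (in_tuple W).
  by rewrite mem_filter => /andP[_ /(parents_past VAR)].
have tnthZ j : (tnth (in_tuple Z) j).2 < t'.
  exact: (parents_past VAR (mem_tnth j (in_tuple Z))).
have U2 j : (fun w => U w 0 j) \in Lfun P 2%:E.
  case: (split_ordP j) => {}j ->; rewrite ?UW ?UZ rowE;
    exact: VAR_Lfun2 VAR _ _.
(* For W this is the assumption of the theorem; Z is in the past of X_t'. *)
have exU j : cross_moment P (eps t' x) (fun w => U w 0 j) = 0.
  case: (split_ordP j) => {}j ->; last first.
    by rewrite UZ rowE (innovation_past_orthogonal VAR).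
  rewrite UW; move/matrixP: epsW => /(_ 0 j); rewrite !mxE => <-.
  by congr (fine 'E_P[_]%E); apply/funext => w; rewrite [RHS]mxE.
have eyU j : cross_moment P (eps t y) (fun w => U w 0 j) = 0.
  case: (split_ordP j) => {}j ->; rewrite ?UW ?UZ rowE.
    by rewrite (innovation_past_orthogonal VAR).
  by rewrite (innovation_past_orthogonal VAR)// (lt_trans (tnthZ j)).
(* In U = (W, Z), x uses Z alone and y uses, besides x, W alone. *)
pose a := col_mx (0 : 'cV[R]_(size W))
  (\col_i lag_coef Phi (x, t') (tnth (in_tuple Z) i)).
pose b := col_mx (\col_i lag_coef Phi (y, t) (tnth (in_tuple W) i))
  (0 : 'cV[R]_(size Z)).
have xE : {ae P, forall w, X t' x w = (U w *m a) 0 0 + eps t' x w}.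
  apply: filterS (VAR_parents VAR (x, t')) => w /= ->; congr (_ + _).
  by rewrite /U /MIT_conditions mul_row_col mulmx0 add0r row_of_nodes_mul.
have yE : {ae P, forall w,
    X t y w = c * X t' x w + (U w *m b) 0 0 + eps t y w}.
  apply: filterS (VAR_parents_without VAR link) => w /= ->.
  have -> : lag_coef Phi (y, t) (x, t') = c.
    by rewrite /lag_coef/= opprB addrC subrK absz_nat.
  congr (_ + _ + _).
  by rewrite /U /MIT_conditions mul_row_col mulmx0 addr0 row_of_nodes_mul.
have Sxx : 0 <= Sigma x x.
  by have [] := gaussian_vector_diag (VAR_innov_gaussian VAR t) x.
have Syy : 0 <= Sigma y y.
  by have [] := gaussian_vector_diag (VAR_innov_gaussian VAR t) y.
rewrite /MIT (partial_correlation_regression U2 SU _ _ _ _ exU eyU _ xE yE).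
- rewrite !(innovation_variance VAR) /sigma_x /sigma_y !sqr_sqrtr//.
  rewrite [in RHS]addrC; set q := Num.sqrt (_ + _).
  (* If Sigma x x = 0, both sides vanish, a division by 0 giving 0. *)
  have [S0|S0] := eqVneq (Sigma x x) 0.
    by rewrite S0 sqrtr0 !(mulr0, mul0r).
  have sx0 : Num.sqrt (Sigma x x) != 0.
    by rewrite sqrtr_eq0 -ltNge lt_neqAle eq_sym S0.
  rewrite -{1}(sqr_sqrtr Sxx) expr2 invfM [c * (_ * _)]mulrA mulrACA.
  by rewrite divff// mulr1.
- exact: VAR_Lfun2 VAR _ _.
- exact: VAR_Lfun2 VAR _ _.
- exact: innovation_Lfun2 VAR _ _.
- exact: innovation_Lfun2 VAR _ _.
- exact: innovation_uncorrelated VAR _ _ _ _ t't.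
Qed.
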